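(* Let $\mathcal X$ be an ordered topological vector space, let $\mathcal A\subset\mathcal X$ be a convex acceptance set, and $S=(S_0,S_T)$ a traded asset. Assume $\rho_{\mathcal A,S}$ does not take the value $-\infty$. The following statements are equivalent: (a) $\operatorname{dom}(\rho_{\mathcal A,S})$ has nonempty interior and $\rho_{\mathcal A,S}$ is continuous on $\operatorname{int}(\operatorname{dom}(\rho_{\mathcal A,S}))$; (b) $\operatorname{int}(\mathcal A)$ is nonempty. In particular, if $\mathcal A$ has nonempty interior then $\rho_{\mathcal A,S}$ is continuous on $\mathcal X$ whenever it is finitely valued.
   Context: An ordered topological vector space $\mathcal X$ is a Hausdorff real topological vector space ordered by a pointed convex cone $\mathcal X_+$ ($\mathcal X_+\cap(-\mathcal X_+)=\{0\}$); $X\le Y$ means $Y-X\in\mathcal X_+$. An acceptance set is a nonempty proper subset $\mathcal A\subset\mathcal X$ such that $X\in\mathcal A$ and $Y\ge X$ imply $Y\in\mathcal A$. A traded asset is a pair $S=(S_0,S_T)$ with $S_0>0$ a real number and $S_T\in\mathcal X_+$ nonzero. The associated risk measure $\rho_{\mathcal A,S}:\mathcal X\to\mathbb R\cup\{\pm\infty\}$ is $$\rho_{\mathcal A,S}(X)=\inf\{m\in\mathbb R : X+\tfrac{m}{S_0}S_T\in\mathcal A\},$$ with $\inf\emptyset=\infty$. Its domain is $\operatorname{dom}(\rho_{\mathcal A,S})=\{X\in\mathcal X : \rho_{\mathcal A,S}(X)<\infty\}$. *)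

(* Defs.v *)
From HB Require Import structures.
From mathcomp Require Import all_boot all_order all_algebra.
From mathcomp Require Import all_classical all_reals all_analysis.

Set Implicit Arguments.
Unset Strict Implicit.
Unset Printing Implicit Defensive.

Import Order.TTheory GRing.Theory Num.Theory.
Import numFieldNormedType.Exports.

Local Open Scope classical_set_scope.
Local Open Scope ring_scope.

(* General topological vector spaces are [topologicalLmodType R]; the library's
   [tvsType R] is not used because it also requires local convexity. *)

Definition convex_cone (R : realType) (E : lmodType R) (C : set E) : Prop :=
  convex_set C /\ forall (t : R) (x : E), 0 <= t -> C x -> C (t *: x).

Definition pointed_convex_cone (R : realType) (E : lmodType R)
    (C : set E) : Prop :=
  convex_cone C /\ C `&` [set - x | x in C] = [set 0].

Definition cone_le (R : realType) (E : lmodType R) (C : set E) (X Y : E) : Prop :=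
  C (Y - X).

Definition acceptance_set (R : realType) (E : lmodType R) (C A : set E) : Prop :=
  [/\ A !=set0,
      A <> setT
    & forall X Y : E, A X -> cone_le C X Y -> A Y].

Record traded_asset (R : realType) (E : lmodType R) (C : set E) := TradedAsset {
  price : R ;
  payoff : E ;
  price_gt0 : 0 < price ;
  payoff_ge0 : C payoff ;
  payoff_neq0 : payoff != 0 }.

(* [ereal_inf set0 = +oo], as required by the convention on empty infima. *)
Definition risk_measure (R : realType) (E : lmodType R) (C A : set E)
    (S : traded_asset C) (X : E) : \bar R :=
  ereal_inf [set m%:E | m in [set m : R | A (X + (m / price S) *: payoff S)]].

Definition risk_dom (R : realType) (E : lmodType R) (C A : set E)
    (S : traded_asset C) : set E :=
  [set X | (risk_measure A S X < +oo)%E].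

(* Main.v *)
Require Import Defs.
From HB Require Import structures.
From mathcomp Require Import all_boot all_order all_algebra.
From mathcomp Require Import all_classical all_reals all_analysis.
From mathcomp Require Import ring lra.

Import Order.TTheory GRing.Theory Num.Theory.
Import numFieldNormedType.Exports.

Local Open Scope classical_set_scope.
Local Open Scope ring_scope.

(** For (a) => (b), [risk_measure A S] is finite at some [X0], equal to [r] say,
    and stays below [r + 1] near [X0]; translating by [r + 1] units of the asset
    turns this into a neighbourhood contained in [A].
    For (b) => (a), an interior point of [A] and a point of the domain slightly
    beyond [X0] span a convex combination showing that one constant [M] bounds
    the risk measure near [X0].  Convexity then squeezes it: with [X0] between
    [Y] and a reflected point, both the upper and the lower deviation at
    distance [s] are of order [s * (M - r)]. *)

(** [convex_set] quantifies over weights bundled in an interval type; this form takes a bare real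
    with its bounds. *)
Lemma convex_setD (R : realType) (E : lmodType R) (A : set E) (t : R) (x y : E) :
  convex_set A -> 0 <= t <= 1 -> A x -> A y -> A (t *: x + (1 - t) *: y).
Proof.
move=> cA t01 Ax Ay.
have t01' : Itv.spec (@Itv.num_sem R) (Itv.Real `[0%Z, 1%Z]) t.
  by rewrite /= /Itv.num_sem/= num_real/= in_itv.
by have := cA x y (Itv.mk t01') (mem_set Ax) (mem_set Ay); rewrite inE.
Qed.

Lemma near_affine (R : realType) (E : topologicalLmodType R) (a : R) (b x : E)
    (P : set E) :
  (\forall y \near a *: x + b, P y) -> \forall y \near x, P (a *: y + b).
Proof.
suff : a *: y + b @[y --> x] --> a *: x + b by apply.
apply: (continuous2_cvg _ (h := +%R)); first exact: (add_continuous (_, _)).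
  apply: (continuous2_cvg _ (V := R^o) (f := cst a) (g := id)
    (h := fun (k : R) (z : E) => k *: z)).
  - exact: (scale_continuous (a, x)).
  - exact: cvg_cst.
  - exact: cvg_id.
exact: cvg_cst.
Qed.

Lemma near_line (R : realType) (E : topologicalLmodType R) (x v : E)
    (P : set E) :
  (\forall y \near x, P y) -> exists2 t : R, 0 < t & P (t *: v + x).
Proof.
move=> Px.
have : t *: v + x @[t --> (0 : R^o)] --> (0 : R) *: v + x.
  apply: (continuous2_cvg _ (h := +%R)); first exact: (add_continuous (_, _)).
    apply: (continuous2_cvg _ (V := R^o) (f := id) (g := cst v)
      (h := fun (k : R) (z : E) => k *: z)).
    - exact: (scale_continuous ((0 : R), v)).
    - exact: cvg_id.
    - exact: cvg_cst.
  exact: cvg_cst.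
rewrite scale0r add0r => /(_ _ Px) /nbhs_ballP[e /= e0 Pe].
exists (e / 2); first by rewrite divr_gt0.
apply: Pe; rewrite /ball /= sub0r normrN gtr0_norm ?divr_gt0 //; lra.
Qed.

Lemma acceptance_payoff_le (R : realType) (E : lmodType R) (C A : set E)
    (S : traded_asset C) (X : E) (m k : R) :
  convex_cone C -> acceptance_set C A -> m <= k ->
  A (X + (m / price S) *: payoff S) -> A (X + (k / price S) *: payoff S).
Proof.
move=> [_ scaleC] [_ _ upA] mk /upA; apply.
rewrite /cone_le opprD addrACA subrr add0r -scalerBl -mulrBl.
apply: scaleC (payoff_ge0 S).
by rewrite mulr_ge0 ?subr_ge0 // invr_ge0 ltW ?price_gt0.
Qed.

Lemma risk_measure_le (R : realType) (E : lmodType R) (C A : set E)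
    (S : traded_asset C) (X : E) (m : R) :
  A (X + (m / price S) *: payoff S) -> (risk_measure A S X <= m%:E)%E.
Proof. by move=> AX; apply: ereal_inf_lbound; exists m. Qed.

Lemma risk_measure_lt (R : realType) (E : lmodType R) (C A : set E)
    (S : traded_asset C) (X : E) (x : \bar R) :
  (risk_measure A S X < x)%E ->
  exists2 m : R, A (X + (m / price S) *: payoff S) & (m%:E < x)%E.
Proof. by move=> /ereal_inf_lt[_ [m Am <-] mx]; exists m. Qed.

(** Convexity of the risk measure, phrased on acceptable pairs of position and amount so that no
    arithmetic in [\bar R] is needed. *)
Lemma acceptance_convex (R : realType) (E : lmodType R) (C A : set E)
    (S : traded_asset C) (X Y : E) (m k t : R) :
  convex_set A -> 0 <= t <= 1 ->
  A (X + (m / price S) *: payoff S) -> A (Y + (k / price S) *: payoff S) ->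
  A ((t *: X + (1 - t) *: Y) +
     ((t * m + (1 - t) * k) / price S) *: payoff S).
Proof.
move=> cA t01 AX AY; have := convex_setD _ _ _ _ _ _ cA t01 AX AY.
by rewrite !scalerDr !scalerA addrACA -scalerDl !mulrA -mulrDl.
Qed.

Lemma risk_measure_near_le (R : realType) (E : topologicalLmodType R)
    (C A : set E) (S : traded_asset C) (X : E) :
  convex_set A -> A° !=set0 -> (risk_dom A S)° X ->
  exists M : R, \forall Y \near X, A (Y + (M / price S) *: payoff S).
Proof.
move=> cA [Z AZ] domX.
have [t t0] := near_line _ _ X (X - Z) _ domX.
set Y := t *: (X - Z) + X => /risk_measure_lt[m AY _].
(* The weight with [X = l *: Y + (1 - l) *: Z], as [l * t = 1 - l]. *)
pose l := (1 + t)^-1.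
have l01 : 0 <= l <= 1.
  by rewrite invr_ge0 invf_le1; lra.
have l1 : 1 - l != 0.
  rewrite /l; have -> : 1 - (1 + t)^-1 = t / (1 + t) by field; lra.
  by rewrite mulf_neq0 ?invr_neq0; lra.
(* The second point of the combination lies in [A] already and costs [0], so only [l * m]
   remains. *)
exists (l * m).
(* Solving [V = l *: Y + (1 - l) *: W] for [W] is affine in [V] and sends [X] to [Z], so points near
   [X] yield [W] in [A]. *)
have lY : (1 - l)^-1 *: X - (1 - l)^-1 *: (l *: Y) = Z.
  rewrite -scalerBr; apply: (scalerI l1); rewrite scalerA mulfV // scale1r.
  rewrite scalerDr scalerA scalerBr.
  have -> : l * t = 1 - l by rewrite /l; field; lra.
  by rewrite addrAC -scalerDl subrK scale1r opprB addrC subrK.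
have /near_affine : \forall W \near ((1 - l)^-1 *: X - (1 - l)^-1 *: (l *: Y)), A W.
  by rewrite lY.
apply: filterS => W AW.
have AW0 : A ((1 - l)^-1 *: W - (1 - l)^-1 *: (l *: Y) + (0 / price S) *: payoff S).
  by rewrite mul0r scale0r addr0.
have := acceptance_convex _ _ _ _ _ _ _ _ _ _ cA l01 AY AW0.
by rewrite mulr0 addr0 -scalerBr scalerA mulfV // scale1r [l *: Y + _]addrC subrK.
Qed.

Lemma risk_measure_continuous_at (R : realType) (E : topologicalLmodType R)
    (C A : set E) (S : traded_asset C) (X : E) (M : R) :
  convex_set A -> risk_measure A S X <> -oo%E ->
  (\forall Y \near X, A (Y + (M / price S) *: payoff S)) ->
  {for X, continuous (risk_measure A S)}.
Proof.
move=> cA rhoNy nearM.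
have rM : (risk_measure A S X <= M%:E)%E.
  by apply: risk_measure_le; exact: nbhs_singleton nearM.
rewrite /prop_for /continuous_at.
case rX : (risk_measure A S X) rM rhoNy => [r| |] //; rewrite lee_fin => rM _.
(* Neighbourhoods of a finite point of [\bar R] unfold to neighbourhoods in [R]. *)
move=> N nbhsN; have /nbhs_ballP[e /= e0 Ne] : nbhs r [set x | N x%:E] := nbhsN.
suff : \forall Y \near X, N (risk_measure A S Y) by [].
(* Chosen so that [s <= 1] and [s * (M - r) < e / 2]; the [+ 1] keeps the latter strict with room to
   spare. *)
pose s := e / (e + 2 * (M - r + 1)).
have d0 : 0 < e + 2 * (M - r + 1) by lra.
have se : s * (e + 2 * (M - r + 1)) = e by rewrite /s mulfVK // gt_eqF.
have s0 : 0 < s by rewrite divr_gt0.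
have sD1 : 1 + s != 0 by rewrite gt_eqF // addr_gt0.
have s1 : s <= 1 by rewrite ler_pdivrMr //; lra.
have ssM : s * (M - r) < e / 2 by nra.
have nearD (a : R) : \forall Y \near X,
    A (X + a *: (Y - X) + (M / price S) *: payoff S).
  have /near_affine : \forall W \near a *: X + (X - a *: X),
      A (W + (M / price S) *: payoff S) by rewrite addrC subrK.
  by apply: filterS => Y; rewrite scalerBr addrCA.
near=> Y.
have AYp : A (X + s^-1 *: (Y - X) + (M / price S) *: payoff S).
  by near: Y; exact: nearD.
have AYm : A (X + (- s^-1) *: (Y - X) + (M / price S) *: payoff S).
  by near: Y; exact: nearD.
have lo : ((r - e / 2)%:E <= risk_measure A S Y)%E.
  apply: le_ereal_inf_tmp => _ [k /= Ak <-]; rewrite lee_fin.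
  (* [X] divides the segment from [Y] to the reflected point with weights [t] and [s * t], whence
     [r * (1 + s) <= k + s * M]. *)
  pose t := (1 + s)^-1.
  have t01 : 0 <= t <= 1 by rewrite invr_ge0 invf_le1; lra.
  have := acceptance_convex _ _ _ _ _ _ _ _ _ _ cA t01 Ak AYm.
  have -> : t *: Y + (1 - t) *: (X + (- s^-1) *: (Y - X)) = X.
    rewrite scalerDr scalerA.
    have -> : (1 - t) * - s^-1 = - t.
      by rewrite /t; field; rewrite sD1 gt_eqF.
    by rewrite scaleNr -scalerN opprB scalerBr addrCA [t *: Y + _]addrC subrK
       -scalerDl subrK scale1r.
  move=> /risk_measure_le; rewrite rX lee_fin => rk.
  have : r * (1 + s) <= k + s * M.
    have -> : k + s * M = (t * k + (1 - t) * M) * (1 + s).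
      by rewrite /t; field.
    by rewrite ler_wpM2r //; lra.
  nra.
have hi : (risk_measure A S Y < (r + e)%:E)%E.
  (* The infimum need not be attained: half of [e] pays for the approximation [m], the other half
     for [s * (M - r)]. *)
  have : (risk_measure A S X < (r + e / 2)%:E)%E by rewrite rX lte_fin; lra.
  move=> /risk_measure_lt[m AX]; rewrite lte_fin => mr.
  have s01 : 0 <= s <= 1 by rewrite ltW.
  have := acceptance_convex _ _ _ _ _ _ _ _ _ _ cA s01 AYp AX.
  have -> : s *: (X + s^-1 *: (Y - X)) + (1 - s) *: X = Y.
    rewrite scalerDr scalerA mulfV ?gt_eqF // scale1r addrAC -scalerDl.
    by rewrite [s + _]addrC subrK scale1r addrC subrK.
  move=> /risk_measure_le /le_lt_trans; apply; rewrite lte_fin; nra.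
case: (risk_measure A S Y) lo hi => [k| |] //.
rewrite lee_fin lte_fin => lo hi; apply: Ne.
rewrite /ball /= ltr_norml; lra.
Unshelve. all: by end_near. Qed.

Theorem theorem3p10 (R : realType) (E : topologicalLmodType R)
    (hausE : hausdorff_space E)
    (C : set E) (coneC : pointed_convex_cone C)
    (A : set E) (accA : acceptance_set C A) (convA : convex_set A)
    (S : traded_asset C)
    (rho_Nninfty : forall X : E, risk_measure A S X <> -oo%E) :
  (((risk_dom A S)° !=set0 /\
      {within (risk_dom A S)°, continuous (risk_measure A S)})
   <-> A° !=set0)
  /\
  (A° !=set0 -> (forall X : E, risk_measure A S X \is a fin_num) ->
     continuous (risk_measure A S)).
Proof.
have contX (X : E) : A° !=set0 -> (risk_dom A S)° X ->
    {for X, continuous (risk_measure A S)}.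
  move=> A0 domX; have [M nearM] := risk_measure_near_le _ _ _ _ _ _ convA A0 domX.
  exact: risk_measure_continuous_at nearM.
split; last first.
  move=> A0 rhofin X; apply: contX => //.
  (* Finiteness makes the domain the whole space, so every point is interior. *)
  have -> : risk_dom A S = setT.
    by apply/seteqP; split=> // Y _; rewrite /risk_dom /= ltey_eq rhofin.
  by rewrite interiorT.
split=> [[[X0 domX0]]|A0].
  rewrite continuous_open_subspace; last exact: open_interior.
  move=> /(_ X0 (mem_set domX0)); rewrite /continuous_at.
  have := nbhs_singleton domX0; rewrite /risk_dom /=.
  case rX : (risk_measure A S X0) (rho_Nninfty X0) => [r| |] // _ _ cvgX0.
  have nearX0 : \forall Y \near X0, A (Y + ((r + 1) / price S) *: payoff S).
    have : \forall Y \near X0, (risk_measure A S Y < (r + 1)%:E)%E.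
      apply: (cvgX0 [set x | (x < (r + 1)%:E)%E]); apply: open_nbhs_nbhs.
      by split; [exact: open_ereal_lt_ereal | rewrite /= lte_fin ltrDl].
    (* The amount [m] depends on [Y]; monotonicity along the payoff replaces it by the uniform
       [r + 1]. *)
    apply: filterS => Y /risk_measure_lt[m AY]; rewrite lte_fin => mr.
    by apply: acceptance_payoff_le AY => //; [case: coneC | exact: ltW].
  set v := ((r + 1) / price S) *: payoff S in nearX0.
  exists (X0 + v); rewrite /interior.
  have /near_affine : \forall Y \near 1 *: (X0 + v) - v, A (Y + v).
    by rewrite scale1r addrK.
  by apply: filterS => Y; rewrite scale1r subrK.
split.
  (* [A] lies in the domain, since the amount [0] is admissible on it. *)
  have [Z AZ] := A0; exists Z; apply: interiorS AZ => X AX.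
  apply: le_lt_trans (ltry 0); apply: risk_measure_le.
  by rewrite mul0r scale0r addr0.
rewrite continuous_open_subspace; last exact: open_interior.
by move=> X; rewrite inE; exact: contX.
Qed.
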